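(* Let $n\in\mathbb{N}$ and let $P_n^{\text{low}}$ be any probability distribution on $S_n$ that satisfies the following conditions: (i) $P_n^{\text{low}}(\sigma_j=n)=\frac1n$ for all $j\in[n]$; (ii) $P_n^{\text{low}}(\sigma_1<\cdots<\sigma_{j-1}\mid\sigma_j=n)=1$ for all $j\in[n]$. Then $P_n^{\text{low}}\big(W_{\mathcal{S}(n,M)}\big)=\frac1n$ for all $M\in\{0,1,\dots,n-1\}$.
   Context: $S_n$ is the set of permutations $\sigma=\sigma_1\cdots\sigma_n$ of $[n]=\{1,\dots,n\}$. In the secretary problem, $n$ items with ranks $1,\dots,n$ arrive one at a time, $\sigma_i$ being the rank of the $i$th item to arrive; $n$ is the highest rank. The observer sees only the relative ranks of the items that have arrived so far. For $M\in\{0,1,\dots,n-1\}$, the strategy $\mathcal{S}(n,M)$ is: reject the first $M$ items, then select the first later-arriving item whose rank is higher than that of each of the first $M$ items, if such an item exists (for $M=0$, this means the first item is selected). $W_{\mathcal{S}(n,M)}\subset S_n$ is the event that the observer using $\mathcal{S}(n,M)$ selects the item of rank $n$. In condition (ii), the event $\sigma_1<\cdots<\sigma_{j-1}$ is vacuously true for $j\in\{1,2\}$. *)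

(* Defs.v *)
From mathcomp Require Import all_boot all_order all_fingroup all_algebra.

Set Implicit Arguments.
Unset Strict Implicit.
Unset Printing Implicit Defensive.

Import GRing.Theory.

Local Open Scope ring_scope.

Record fdist (R : realFieldType) (T : finType) := FDist {
  pmf :> T -> R;
  pmf_ge0 : forall x, 0 <= pmf x;
  pmf_sum1 : \sum_x pmf x = 1
}.

Definition Pr (R : realFieldType) (T : finType) (P : fdist R T) (A : {set T}) : R :=
  \sum_(x in A) P x.

(* Only meaningful when [Pr P B != 0] (otherwise the quotient is [0]). *)
Definition cPr (R : realFieldType) (T : finType) (P : fdist R T) (A B : {set T}) : R :=
  Pr P (A :&: B) / Pr P B.

Section Secretary.

Variable n : nat.

(* Positions are shifted by one: [i : 'I_n] stands for the (i+1)-st arrival.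
   Ranks keep their usual values 1, ..., n. *)
Definition rank (s : 'S_n) (i : 'I_n) : nat := (s i).+1.

Definition best_at (j : 'I_n) : {set 'S_n} := [set s | rank s j == n].

Definition increasing_before (j : 'I_n) : {set 'S_n} :=
  [set s | [forall a : 'I_n, forall b : 'I_n,
              (a < b < j)%N ==> (rank s a < rank s b)%N]].

(* With the shift, the first [M] arrivals are the positions [k < M]. *)
Definition beats_first (M : nat) (s : 'S_n) (i : 'I_n) : bool :=
  [forall k : 'I_n, (k < M)%N ==> (rank s k < rank s i)%N].

(* [enum 'I_n] is in increasing order, so the head is the earliest candidate;
   [None] means that no item is selected. *)
Definition selected (M : nat) (s : 'S_n) : option 'I_n :=
  ohead [seq i : 'I_n <- enum 'I_n | (M <= i)%N && beats_first M s i].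

Definition win (M : nat) : {set 'S_n} :=
  [set s | if selected M s is Some i then rank s i == n else false].

End Secretary.

(* Main.v *)
Require Import Defs.
From mathcomp Require Import all_boot all_order all_fingroup all_algebra.

(** Condition (ii) says that, almost surely, the ranks that arrive before the
    best item are increasing.  Under such an ordering, the first item arriving
    after the rejected ones (position [M]) either comes before the best item,
    and then beats all its predecessors and is selected wrongly; or is the best
    item, and is selected rightly; or comes after the best item, which has then
    been rejected.  So up to a null set the strategy wins exactly when the best
    item is at position [M] ([win_iff_best_at]), an event of probability [1 / n]
    by (i).  Condition (i) also makes the conditioning events of (ii) non-null,
    so that the conditional probabilities really carry information
    ([cPr1_null]). *)

Import GRing.Theory Num.Theory.

Local Open Scope ring_scope.

(** The mass of [B] equals that of [A :&: B], so the nonnegative masses of the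
    points of [B :\: A] sum to [0]. *)
Lemma cPr1_null (R : realFieldType) (T : finType) (P : fdist R T)
    (A B : {set T}) (x : T) :
  Pr P B != 0 -> cPr P A B = 1 -> x \in B -> x \notin A -> P x = 0.
Proof.
move=> B_neq0 /(congr1 ( *%R^~ (Pr P B))).
rewrite /cPr divfK // mul1r => eqAB xB xA.
have : \sum_(y in B :\: A) P y = 0.
  have : Pr P B = Pr P (A :&: B) + \sum_(y in B :\: A) P y.
    by rewrite /Pr (big_setID A) setIC.
  by rewrite eqAB -{1}[Pr P B]addr0 => /addrI.
by move/psumr_eq0P; apply=> [y _|]; rewrite ?pmf_ge0 // inE xA.
Qed.

Lemma eq_Pr_supp (R : realFieldType) (T : finType) (P : fdist R T)
    (A B : {set T}) :
  (forall x, P x != 0 -> (x \in A) = (x \in B)) -> Pr P A = Pr P B.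
Proof.
move=> eqAB; rewrite /Pr big_mkcond [RHS]big_mkcond; apply: eq_bigr => x _.
by case: (eqVneq (P x) 0) => [->|/eqAB ->]; rewrite ?if_same.
Qed.

Section Selection.

Variable n : nat.
Implicit Types (s : 'S_n) (i m : 'I_n).

Lemma selected_ge {M s i} : selected M s = Some i -> (M <= i)%N.
Proof.
rewrite /selected; case def_t: [seq _ <- _ | _] => [|x t] //= [<-].
have : x \in x :: t by rewrite mem_head.
by rewrite -def_t mem_filter => /andP[/andP[]].
Qed.

(** Position [m] is the earliest one that the strategy with [m] rejections may
    select, so it is selected as soon as it is eligible. *)
Lemma selected_first {s m} : beats_first m s m -> selected m s = Some m.
Proof.
move=> m_beats; rewrite /selected.
have lt_trans_ord : transitive (relpre (@nat_of_ord n) ltn).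
  by move=> ? ? ?; apply: ltn_trans.
have : sorted (relpre (@nat_of_ord n) ltn)
    [seq i : 'I_n <- enum 'I_n | (m <= i)%N && beats_first m s i].
  apply: sorted_filter => //.
  by rewrite -sorted_map val_enum_ord iota_ltn_sorted.
have : m \in [seq i : 'I_n <- enum 'I_n | (m <= i)%N && beats_first m s i].
  by rewrite mem_filter leqnn m_beats mem_enum.
case def_t: [seq _ <- _ | _] => [|x t] //=.
have le_mx : (m <= x)%N.
  have : x \in x :: t by rewrite mem_head.
  by rewrite -def_t mem_filter => /andP[/andP[]].
rewrite inE => /predU1P[-> // | mt] /(order_path_min lt_trans_ord)/allP/(_ m mt).
by rewrite /= ltnNge le_mx.
Qed.

Lemma best_beats_first {s m} : s \in best_at m -> beats_first m s m.
Proof.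
rewrite inE => /eqP best_m; apply/forallP=> k; apply/implyP=> lt_km.
rewrite ltn_neqAle {2}best_m ltn_ord andbT eqSS.
by rewrite (inj_eq val_inj) (inj_eq perm_inj) neq_ltn lt_km.
Qed.

Lemma increasing_beats_first {s j m} :
  s \in increasing_before j -> (m < j)%N -> beats_first m s m.
Proof.
rewrite inE => /forallP incr lt_mj; apply/forallP=> k; apply/implyP=> lt_km.
by have /forallP/(_ m)/implyP := incr k; apply; rewrite lt_km.
Qed.

(** If the best item came later than [m], the item at [m] would beat its
    predecessors and be selected in its place. *)
Lemma win_iff_best_at s m :
  (forall j : 'I_n, s \in best_at j -> s \in increasing_before j) ->
  (s \in win n m) = (s \in best_at m).
Proof.
move=> incr; apply/idP/idP => [|best_m]; last first.
  by rewrite inE selected_first ?best_beats_first //; move: best_m; rewrite inE.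
rewrite inE; case sel: selected => [i|] // best_i.
have {}best_i : s \in best_at i by rewrite inE.
have := selected_ge sel; rewrite leq_eqVlt => /predU1P[/val_inj -> // | lt_mi].
have := selected_first (increasing_beats_first (incr i best_i) lt_mi).
by rewrite sel => -[<-].
Qed.

End Selection.

Theorem proposition1 (R : realFieldType) (n : nat) (n_gt0 : (0 < n)%N)
    (P : fdist R 'S_n)
    (best_unif : forall j : 'I_n, Pr P (best_at j) = 1 / n%:R)
    (incr_before_best :
       forall j : 'I_n, cPr P (increasing_before j) (best_at j) = 1) :
  forall M : nat, (M < n)%N -> Pr P (win n M) = 1 / n%:R.
Proof.
move=> M lt_Mn; rewrite -(best_unif (Ordinal lt_Mn)).
apply: eq_Pr_supp => s Ps_neq0.
apply: (@win_iff_best_at n s (Ordinal lt_Mn)) => j best_j.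
apply: contraNT Ps_neq0 => not_incr; apply/eqP.
apply: cPr1_null (incr_before_best j) best_j not_incr.
by rewrite best_unif mul1r invr_eq0 pnatr_eq0 -lt0n.
Qed.
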